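(* Let $R$ be a ring and $M$ an $R$-module. The ring $R\ltimes M$ is weakly Laskerian if and only if $R$ is a weakly Laskerian ring and $M$ is a weakly Laskerian $R$-module.
   Context: All rings are commutative with identity. For an $R$-module $M$, $\operatorname{Ass}_R M$ denotes the set of prime ideals $\mathfrak p$ of $R$ of the form $\mathfrak p=(0:_R x)$ for some $x\in M$. An $R$-module $M$ is weakly Laskerian if $\operatorname{Ass}_R(M/N)$ is a finite set for every submodule $N$ of $M$. A ring is weakly Laskerian if it is weakly Laskerian as a module over itself. The trivial ring extension (idealization) $R\ltimes M$ is the set $R\times M$ with addition $(r_1,m_1)+(r_2,m_2)=(r_1+r_2,m_1+m_2)$ and multiplication $(r_1,m_1)(r_2,m_2)=(r_1r_2,\,r_1m_2+r_2m_1)$; it is a commutative ring with identity $(1,0)$. *)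

(* Defs.v *)
From HB Require Import structures.
From mathcomp Require Import all_boot all_order all_algebra.
From mathcomp Require Import generic_quotient ring_quotient.
From mathcomp Require Import boolp classical_sets functions cardinality.

Set Implicit Arguments.
Unset Strict Implicit.
Unset Printing Implicit Defensive.

Import GRing.Theory.

Local Open Scope ring_scope.
Local Open Scope quotient_scope.
Local Open Scope classical_set_scope.

(* Rings are [comPzRingType] and not [comNzRingType] so that the zero ring is
   allowed.  Submodules and ideals are boolean predicates, following
   [submodClosed] and [prime_idealr]; since [boolp] is assumed, this is no
   restriction. *)

Section ModuleQuotient.
Variables (R : pzRingType) (M : lmodType R) (N : submodClosed M).

(* [submodClosed] is stated over semirings, so it does not inherit from
   [zmodClosed]; closure under opposites comes from scaling by -1. *)
Fact submodClosedN : oppr_closed N.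
Proof. by move=> x Nx; rewrite -scaleN1r rpredZ. Qed.

Definition submod_zmodClosed : zmodClosed M :=
  HB.pack_for (zmodClosed M) (N : {pred M})
    (GRing.AddClosed.on N)
    (GRing.isOppClosed.Build M N submodClosedN).

Definition modquot : Type := Quotient.quot submod_zmodClosed.

HB.instance Definition _ :=
  GRing.Zmodule.copy modquot (Quotient.quot submod_zmodClosed).

Definition mqpi (x : M) : modquot := \pi_(Quotient.quot submod_zmodClosed) x.

Definition mqrepr (q : modquot) : M := repr (q : Quotient.quot submod_zmodClosed).

Lemma mqpi_eq (x y : M) : (mqpi x == mqpi y) = (x - y \in N).
Proof. exact: esym (Quotient.idealrBE submod_zmodClosed x y). Qed.

Lemma mqpiD : {morph mqpi : x y / x + y}.
Proof. exact: raddfD. Qed.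

Lemma mqreprK (q : modquot) : mqpi (mqrepr q) = q.
Proof. exact: reprK. Qed.

Definition mqscale (a : R) (q : modquot) : modquot := mqpi (a *: mqrepr q).

Lemma mqpiZ (a : R) (x : M) : mqscale a (mqpi x) = mqpi (a *: x).
Proof.
by apply/eqP; rewrite mqpi_eq -scalerBr rpredZ // -mqpi_eq mqreprK.
Qed.

Fact mqscaleA (a b : R) (q : modquot) :
  mqscale a (mqscale b q) = mqscale (a * b) q.
Proof. by rewrite -[q]mqreprK !mqpiZ scalerA. Qed.

Fact mqscale1 : left_id 1 mqscale.
Proof. by move=> q; rewrite -[q]mqreprK mqpiZ scale1r. Qed.

Fact mqscaleDr : right_distributive mqscale +%R.
Proof.
move=> a q r; rewrite -[q]mqreprK -[r]mqreprK.
by rewrite -mqpiD !mqpiZ scalerDr mqpiD.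
Qed.

Fact mqscaleDl (q : modquot) : {morph mqscale^~ q : a b / a + b}.
Proof. by move=> a b; rewrite -[q]mqreprK !mqpiZ scalerDl mqpiD. Qed.

HB.instance Definition _ := GRing.Zmodule_isLmodule.Build R modquot
  mqscaleA mqscale1 mqscaleDr mqscaleDl.

Fact mqpi_is_linear : linear mqpi.
Proof. by move=> a x y; rewrite mqpiD -mqpiZ. Qed.

HB.instance Definition _ := GRing.isLinear.Build R M modquot *:%R mqpi
  mqpi_is_linear.

End ModuleQuotient.

Section WeaklyLaskerian.

(* The clauses of [prime_idealr], which the library states only over nonzero
   rings. *)
Definition prime_ideal (R : comPzRingType) (p : {pred R}) : Prop :=
  [/\ 0 \in p, 1 \notin p,
      forall a, {in p &, forall u v, a * u + v \in p}
    & forall u v, u * v \in p -> (u \in p) || (v \in p)].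

Definition annihilator (R : comPzRingType) (M : lmodType R) (x : M) : {pred R} :=
  fun r => r *: x == 0.

Definition Ass (R : comPzRingType) (M : lmodType R) : set {pred R} :=
  [set p | prime_ideal p /\ exists x : M, p = annihilator x].

Definition weakly_Laskerian (R : comPzRingType) (M : lmodType R) : Prop :=
  forall N : submodClosed M, finite_set (Ass (modquot N)).

Definition weakly_Laskerian_ring (R : comPzRingType) : Prop :=
  weakly_Laskerian R^o.

End WeaklyLaskerian.

(* An alias, so that the multiplication below is not confused with the
   componentwise structures on [R * M]. *)
Definition trivext (R : comPzRingType) (M : lmodType R) : Type := (R * M)%type.

Section TrivialExtension.
Variables (R : comPzRingType) (M : lmodType R).
Local Notation E := (trivext M).

HB.instance Definition _ := GRing.Zmodule.copy E (R * M)%type.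

Definition trivext_one : E := (1, 0).

Definition trivext_mul (x y : E) : E :=
  (x.1 * y.1, x.1 *: y.2 + y.1 *: x.2).

Fact trivext_mulA : associative trivext_mul.
Proof.
move=> [a m] [b n] [c o]; rewrite /trivext_mul /= mulrA !scalerDr !scalerA.
by rewrite addrA (mulrC c a) (mulrC c b).
Qed.

Fact trivext_mulC : commutative trivext_mul.
Proof. by move=> x y; rewrite /trivext_mul mulrC addrC. Qed.

Fact trivext_mul1 : left_id trivext_one trivext_mul.
Proof.
by move=> [a m]; rewrite /trivext_mul /= mul1r scale1r scaler0 addr0.
Qed.

Fact trivext_mulDl : left_distributive trivext_mul +%R.
Proof.
move=> [a m] [b n] [c o]; congr pair; first exact: mulrDl.
by rewrite /= scalerDl scalerDr addrACA.
Qed.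

HB.instance Definition _ := GRing.Zmodule_isComPzRing.Build E
  trivext_mulA trivext_mulC trivext_mul1 trivext_mulDl.

Lemma trivextDE (x y : E) : x + y = (x.1 + y.1, x.2 + y.2) :> E.
Proof. by []. Qed.

Lemma trivextME (x y : E) : x * y = (x.1 * y.1, x.1 *: y.2 + y.1 *: x.2) :> E.
Proof. by []. Qed.

End TrivialExtension.

(* Main.v *)
(** Since [0 * M] squares to zero, every prime of [R |x M] has the form
    [p * M] with [p] a prime of [R].  Given an ideal [I], the exact sequence
    [0 -> M/N -> (R |x M)/I -> R/J -> 0], where [N = {m | (0, m) \in I}] and [J]
    is the projection of [I] to [R], shows that if [p * M] is associated to
    [(R |x M)/I] then [p] is associated to [M/N] or to [R/J].  Conversely [R/J]
    and [M/N] are the modules [(R |x M)/(J * M)] and [(0 * M)/(0 * N)]. *)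

From HB Require Import structures.
Require Import Defs.
From mathcomp Require Import all_boot all_algebra.
From mathcomp Require Import boolp classical_sets cardinality.

Set Implicit Arguments.
Unset Strict Implicit.
Unset Printing Implicit Defensive.

Import GRing.Theory.

Local Open Scope ring_scope.
Local Open Scope classical_set_scope.

Section Colon.
Variables (R : comPzRingType) (M : lmodType R).

Definition colon (S : {pred M}) (x : M) : {pred R} := fun r => r *: x \in S.

Lemma annihilator_mqpi (N : submodClosed M) (x : M) :
  annihilator (mqpi N x) = colon N x.
Proof.
apply/funext => r; rewrite /annihilator /colon -linearZ.
by rewrite -(linear0 (mqpi N)) mqpi_eq subr0.
Qed.

(** The annihilator of the class of [x] in [M/N] is the colon of [N] by [x]; with this form, no
    later argument handles quotient modules. *)
Lemma weakly_LaskerianP :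
  weakly_Laskerian M <->
  forall S : {pred M}, submod_closed S ->
    finite_set [set p | prime_ideal p /\ exists x, p = colon S x].
Proof.
split=> [wM S Ssub | wM N].
  pose N := HB.pack_for (submodClosed M) (S : M -> bool)
    (GRing.isSubmodClosed.Build R M S Ssub).
  apply: sub_finite_set (wM N) => p [pp [x defp]].
  by split=> //; exists (mqpi N x); rewrite defp annihilator_mqpi.
apply: sub_finite_set (wM N (submodClosedP N)) => p [pp [q defp]].
by split=> //; exists (mqrepr q); rewrite -annihilator_mqpi mqreprK.
Qed.

End Colon.

Section TrivialExtension.
Variables (R : comPzRingType) (M : lmodType R).
Local Notation E := (trivext M).

Definition trivext_extend (p : {pred R}) : {pred E} := fun x => x.1 \in p.

Definition trivext_restrict (P : {pred E}) : {pred R} :=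
  fun r => ((r, 0) : E) \in P.

Lemma trivext_extendK : cancel trivext_extend trivext_restrict.
Proof. by []. Qed.

Lemma prime_trivext_extend (p : {pred R}) :
  prime_ideal p -> prime_ideal (trivext_extend p).
Proof.
case=> p0 p1 pD pM; split=> //.
- by move=> a x y px py; exact: pD.
- by move=> x y; exact: pM.
Qed.

(** Primes pull back along the ring morphism sending [r] to [(r, 0)]. *)
Lemma prime_trivext_restrict (P : {pred E}) :
  prime_ideal P -> prime_ideal (trivext_restrict P).
Proof.
case=> P0 P1 PD PM; split=> //.
- move=> a u v Pu Pv; rewrite unfold_in.
  have := PD (a, 0) _ _ Pu Pv.
  by rewrite trivextME trivextDE /= !scaler0 !addr0.
- move=> u v; rewrite unfold_in => Puv; apply: PM.
  by rewrite trivextME /= !scaler0 addr0.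
Qed.

Lemma prime_nil (P : {pred E}) (m : M) : prime_ideal P -> (0, m) \in P.
Proof.
(* Duplicating the membership lets primality apply to the square of [(0, m)], which is zero. *)
case=> P0 _ _ PM; rewrite -[_ \in P]orbb; apply: PM.
by rewrite trivextME /= mul0r scale0r addr0.
Qed.

(** [(r, m)] and [(r, 0)] differ by an element [(0, m)], which lies in every prime. Hence finiteness
    of a set of primes can be checked on restrictions to [R]. *)
Lemma trivext_restrictK (P : {pred E}) :
  prime_ideal P -> trivext_extend (trivext_restrict P) = P.
Proof.
move=> Pp; apply/funext => -[r m]; have [_ _ PD _] := Pp.
rewrite /trivext_extend /trivext_restrict /= !unfold_in /=.
apply/idP/idP => h.
- have := PD 1 _ _ h (prime_nil m Pp).
  by rewrite mul1r trivextDE /= addr0 add0r.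
- have := PD 1 _ _ h (prime_nil (- m) Pp).
  by rewrite mul1r trivextDE /= addr0 subrr.
Qed.

Lemma weakly_Laskerian_trivext_base :
  weakly_Laskerian_ring E -> weakly_Laskerian_ring R.
Proof.
move/weakly_LaskerianP=> wE; apply/weakly_LaskerianP => J [J0 Jlin].
have Isub : @submod_closed E E^o (trivext_extend J).
  by split=> // a x y; exact: (Jlin a.1).
apply: sub_finite_set (finite_image trivext_restrict (wE _ Isub)).
move=> p [pp [a defp]]; exists (trivext_extend p); last exact: trivext_extendK.
split; first exact: prime_trivext_extend.
(* The colon of [J * M] by [(a, 0)] only tests first components, so it is the extension of the colon
   of [J] by [a]. *)
by exists (a, 0); rewrite defp.
Qed.

Lemma weakly_Laskerian_trivext_module :
  weakly_Laskerian_ring E -> weakly_Laskerian M.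
Proof.
move/weakly_LaskerianP=> wE; apply/weakly_LaskerianP => N [N0 Nlin].
pose I : {pred E^o} := fun x => (x.1 == 0) && (x.2 \in N).
have Isub : @submod_closed E E^o I.
  split=> [|a x y]; first by rewrite unfold_in /= eqxx.
  rewrite !unfold_in => /andP[/eqP x1 x2] /andP[/eqP y1 y2] /=.
  by rewrite x1 y1 mulr0 addr0 eqxx scale0r addr0; exact: Nlin.
apply: sub_finite_set (finite_image trivext_restrict (wE _ Isub)).
move=> p [pp [k defp]]; exists (trivext_extend p); last exact: trivext_extendK.
split; first exact: prime_trivext_extend.
(* Since [(r, n) * (0, k) = (0, r *: k)], the colon of [I] by [(0, k)] is the extension of the colon
   of [N] by [k]. *)
exists (0, k); rewrite defp; apply/funext => -[r n].
rewrite /trivext_extend /colon !unfold_in /=.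
by rewrite mulr0 eqxx scale0r addr0.
Qed.

Lemma weakly_Laskerian_trivext :
  weakly_Laskerian_ring R -> weakly_Laskerian M -> weakly_Laskerian_ring E.
Proof.
move=> /weakly_LaskerianP wR /weakly_LaskerianP wM.
apply/weakly_LaskerianP => I [I0 Ilin].
pose N : {pred M} := fun m => ((0, m) : E) \in I.
have Nsub : submod_closed N.
  split=> // r x y Nx Ny; rewrite unfold_in.
  have := Ilin (r, 0) _ _ Nx Ny.
  by congr (_ \in I); congr pair; rewrite /= ?mulr0 ?addr0 ?scale0r ?addr0.
pose J : {pred R^o} := fun a => `[< exists m, ((a, m) : E) \in I >].
have Jsub : @submod_closed R R^o J.
  split=> [|r x y]; first by apply/asboolP; exists 0.
  move=> /asboolP[m Im] /asboolP[n In]; apply/asboolP.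
  by eexists; exact: (Ilin (r, 0) _ _ Im In).
have finA : finite_set
    ([set p | prime_ideal p /\ exists x, p = colon J x] `|`
     [set p | prime_ideal p /\ exists x, p = colon N x]).
  by rewrite finite_setU; split; [exact: wR | exact: wM].
apply: sub_finite_set (finite_image trivext_extend finA).
move=> P [Pp [[a m] defP]]; exists (trivext_restrict P); last first.
  exact: trivext_restrictK.
have rPp := prime_trivext_restrict Pp.
have IZ (e x : E) : x \in I -> e * x \in I.
  by move=> Ix; rewrite -[e * x]addr0; exact: Ilin.
have IB (x y : E) : x - y \in I -> (x \in I) = (y \in I).
  move=> Ixy; apply/idP/idP => h.
    by have := Ilin (-1) _ _ Ixy h; rewrite scaleN1r opprB subrK.
  by have := Ilin 1 _ _ Ixy h; rewrite scale1r subrK.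
have memP (x : E) : (x \in P) = (x * (a, m) \in I) by rewrite defP.
have [_ _ PD PM] := Pp.
have PZ (e x : E) : x \in P -> e * x \in P.
  by rewrite !memP -mulrA; exact: IZ.
(* The class of [(a, m)] generates a copy of [E/P] in [E/I]. Either this copy meets the image of
   [M/N] in a nonzero class, that of [x * (a, m)], or it embeds in [R/J]. *)
have [[x [nPx [k Ik]]] | noJ] := pselect (exists x : E,
    x \notin P /\ exists k, x * (a, m) - (0, k) \in I).
- right; split=> //; exists k; apply/funext => s.
  (* [P] is also the colon of [x * (a, m)], as [x] is not in the prime [P],
     and that element equals [(0, k)] modulo [I]. *)
  have -> : trivext_restrict P s = (x * (s, 0) \in P).
    apply/idP/idP => [|/PM]; first exact: PZ.
    by rewrite (negPf nPx).
  rewrite memP mulrAC mulrC.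
  have := IZ (s, 0) _ Ik; rewrite mulrBr => /IB ->.
  by rewrite [((s, 0) : E) * _]trivextME /= mulr0 scale0r addr0.
- left; split=> //; exists a; apply/funext => s.
  apply/idP/idP => [|/asboolP[m' Im']].
    rewrite /trivext_restrict memP trivextME => h.
    by apply/asboolP; eexists; exact: h.
  apply/negPn/negP => nPs; apply: noJ; exists (s, 0); split=> //.
  (* Subtracting [(0, s *: m - m')] from [(s, 0) * (a, m)] leaves [(s * a, m')], which is in [I]. *)
  exists (s *: m - m').
  rewrite trivextME /= scaler0 addr0 trivextDE /=.
  by rewrite subr0 opprB addrCA subrr addr0.
Qed.

End TrivialExtension.

Theorem theorem3p4 (R : comPzRingType) (M : lmodType R) :
  weakly_Laskerian_ring (trivext M) <->
  weakly_Laskerian_ring R /\ weakly_Laskerian M.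
Proof.
split=> [wE | [wR wM]]; last exact: weakly_Laskerian_trivext.
split; last exact: weakly_Laskerian_trivext_module.
exact: weakly_Laskerian_trivext_base wE.
Qed.
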